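(* Let $a,k,\gamma,h_0,u_\infty>0$ be constants, and let $\beta,\delta$ be real constants with $\beta\ge\delta$ and $\beta+\delta+1>0$. Put $\alpha=\beta-\delta$. Then there exists a unique solution $(u_R,s_R)$ of similarity type to the free boundary problem $(P_R)$ with Robin condition: $$\frac{\partial u}{\partial t}=a^2\frac{\partial^2u}{\partial x^2}\quad(0<x<s(t),\ t>0),\qquad u(s(t),t)=0\quad (t>0),$$ $$-k\frac{\partial u}{\partial x}(s(t),t)=\gamma\, s^{\beta}(t)\,\dot s^{\delta}(t)\,\dot s(t)\quad (t>0),\qquad s(0)=0,$$ $$k\frac{\partial u}{\partial x}(0,t)=\frac{h_0}{\sqrt t}\left[u(0,t)-u_\infty t^{\alpha/2}\right]\quad (t>0).$$ It is given by $$u_R(x,t)=t^{\alpha/2}\left[C_{1R}M\left(-\tfrac{\alpha}{2},\tfrac12,-\eta^2\right)+C_{2R}\,\eta\, M\left(-\tfrac{\alpha}{2}+\tfrac12,\tfrac32,-\eta^2\right)\right],\quad \eta=\frac{x}{2a\sqrt t},\qquad s_R(t)=2\xi_Ra\sqrt t,$$ where $$C_{1R}=\frac{u_\infty\xi_R M(-\frac{\alpha}{2}+\frac12,\frac32,-\xi_R^2)}{\frac{k}{2ah_0}M(-\frac{\alpha}{2},\frac12,-\xi_R^2)+\xi_RM(-\frac{\alpha}{2}+\frac12,\frac32,-\xi_R^2)},\qquad C_{2R}=\frac{-u_\infty M(-\frac{\alpha}{2},\frac12,-\xi_R^2)}{\frac{k}{2ah_0}M(-\frac{\alpha}{2},\frac12,-\xi_R^2)+\xi_RM(-\frac{\alpha}{2}+\frac12,\frac32,-\xi_R^2)},$$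 and $\xi_R$ is the unique positive solution of the equation $$\frac{ku_\infty}{\gamma2^{\beta+1}a^{\beta+\delta+2}}\,f_1(z)=z^{\beta+\delta+1},\quad z>0,\qquad f_1(z)=\frac{1}{\frac{k}{2ah_0}M(\frac{\alpha}{2}+\frac12,\frac12,z^2)+zM(\frac{\alpha}{2}+1,\frac32,z^2)}.$$
   Context: $M$ is Kummer's confluent hypergeometric function of the first kind, $M(p,q,z)=\sum_{n=0}^{\infty}\frac{(p)_n}{(q)_n}\frac{z^n}{n!}$, with $(p)_0=1$, $(p)_n=p(p+1)\cdots(p+n-1)$ ($q$ not a non-positive integer). The dot denotes $d/dt$. The unknowns of the problem are the function $u=u(x,t)$, $0\le x\le s(t)$, $t>0$, and the moving boundary $x=s(t)$. A solution $(u,s)$ is of similarity type if $u(x,t)=t^{\alpha/2}\varphi(\eta)$ with $\eta=\frac{x}{2a\sqrt t}$ for a function $\varphi$ twice continuously differentiable on $[0,\xi]$, and $s(t)=2\xi a\sqrt t$ for a constant $\xi>0$. *)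

(* Defs.v *)
From Stdlib Require Import Reals Factorial.
From Coquelicot Require Import Coquelicot.
Open Scope R_scope.

Fixpoint pochhammer (p : R) (n : nat) : R :=
  match n with
  | O => 1
  | S m => pochhammer p m * (p + INR m)
  end.

Definition kummerM (p q z : R) : R :=
  PSeries (fun n => pochhammer p n / pochhammer q n / INR (fact n)) z.

Definition cc_interval (lo hi : R) : R -> Prop := fun x => lo <= x <= hi.

(* Derivative relative to a subset [D]: the difference quotient only sees
   points of [D], so this is the one-sided derivative at an endpoint. *)
Definition is_derive_on (f : R -> R) (D : R -> Prop) (x l : R) : Prop :=
  D_in f (fun _ => l) D x.

Definition C2_on (f : R -> R) (D : R -> Prop) : Prop :=
  exists f1 f2 : R -> R, forall x, D x ->
    is_derive_on f D x (f1 x) /\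
    is_derive_on f1 D x (f2 x) /\
    continue_in f2 D x.

(* A pair (u, s) stands for a function u on {0 <= x <= s t, t > 0} and a
   function s on {t >= 0}; the values of the Rocq functions elsewhere are
   irrelevant.  Accordingly the x-derivatives on the two boundaries are taken
   relative to [0, s t].  In the Stefan condition, [Rpower] is a genuine real
   power because s and its derivative are positive for similarity solutions. *)
Definition robin_problem (a k gamma h0 uinf beta delta : R)
    (u : R -> R -> R) (s : R -> R) : Prop :=
  (forall x t, 0 < t -> 0 < x < s t ->
     ex_derive (fun tau => u x tau) t /\
     ex_derive (fun y => u y t) x /\
     ex_derive_n (fun y => u y t) 2 x /\
     Derive (fun tau => u x tau) t = a ^ 2 * Derive_n (fun y => u y t) 2 x) /\
  (forall t, 0 < t -> u (s t) t = 0) /\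
  (forall t, 0 < t ->
     ex_derive s t /\
     exists ux, is_derive_on (fun x => u x t) (cc_interval 0 (s t)) (s t) ux /\
       - k * ux =
         gamma * Rpower (s t) beta * Rpower (Derive s t) delta * Derive s t) /\
  s 0 = 0 /\
  (forall t, 0 < t ->
     exists ux, is_derive_on (fun x => u x t) (cc_interval 0 (s t)) 0 ux /\
       k * ux =
         h0 / sqrt t * (u 0 t - uinf * Rpower t ((beta - delta) / 2))).

Definition similarity_type (a alpha : R)
    (u : R -> R -> R) (s : R -> R) : Prop :=
  exists (phi : R -> R) (xi : R),
    0 < xi /\
    C2_on phi (cc_interval 0 xi) /\
    (forall t, 0 < t -> s t = 2 * xi * a * sqrt t) /\
    (forall x t, 0 < t -> 0 <= x <= s t ->
       u x t = Rpower t (alpha / 2) * phi (x / (2 * a * sqrt t))).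

Definition robin_denominator (a k h0 alpha xi : R) : R :=
  k / (2 * a * h0) * kummerM (- alpha / 2) (1 / 2) (- xi ^ 2)
  + xi * kummerM (- alpha / 2 + 1 / 2) (3 / 2) (- xi ^ 2).

Definition C1R (a k h0 uinf alpha xi : R) : R :=
  uinf * xi * kummerM (- alpha / 2 + 1 / 2) (3 / 2) (- xi ^ 2)
  / robin_denominator a k h0 alpha xi.

Definition C2R (a k h0 uinf alpha xi : R) : R :=
  - uinf * kummerM (- alpha / 2) (1 / 2) (- xi ^ 2)
  / robin_denominator a k h0 alpha xi.

Definition uR (a k h0 uinf alpha xi x t : R) : R :=
  let eta := x / (2 * a * sqrt t) in
  Rpower t (alpha / 2) *
  (C1R a k h0 uinf alpha xi * kummerM (- alpha / 2) (1 / 2) (- eta ^ 2)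
   + C2R a k h0 uinf alpha xi * eta
     * kummerM (- alpha / 2 + 1 / 2) (3 / 2) (- eta ^ 2)).

Definition sR (a xi t : R) : R := 2 * xi * a * sqrt t.

Definition f1 (a k h0 alpha z : R) : R :=
  1 / (k / (2 * a * h0) * kummerM (alpha / 2 + 1 / 2) (1 / 2) (z ^ 2)
       + z * kummerM (alpha / 2 + 1) (3 / 2) (z ^ 2)).

(* Main.v *)
(* For u = t^(alpha/2) phi(eta) and s = 2 xi a sqrt t the problem reduces to
   phi'' + 2 eta phi' - 2 alpha phi = 0 on (0, xi) with a Robin condition at 0
   and two conditions at xi.  The Kummer functions phi1, phi2 of the statement
   solve this equation with Cauchy data (1, 0) and (0, 1).  The Wronskian of any
   two solutions is a multiple of exp (- eta^2), so Wronskians against phi1 and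
   phi2 force phi = phi(0) phi1 + phi'(0) phi2, and the Robin condition together
   with phi(xi) = 0 gives phi = C1R phi1 + C2R phi2.  The same representation
   yields Kummer's transformation M(p,q,-z) = exp(-z) M(q-p,q,z) for z = eta^2 and
   q = 1/2, 3/2, since exp(-eta^2) times the functions in f1 solves the equation.
   Hence phi'(xi) = - u_infinity f1(xi), and the Stefan condition becomes the
   equation for xi: the denominator of f1 has nonnegative Taylor coefficients,
   so z^(beta+delta+1) / f1(z) increases strictly from 0 to infinity. *)

Require Import Defs.
From Stdlib Require Import Reals Factorial Lra.
From Coquelicot Require Import Coquelicot.
Open Scope R_scope.

(** * Kummer's series: convergence on the whole line, derivatives, differential equation *)

Definition kummer_coef (p q : R) (n : nat) : R :=
  pochhammer p n / pochhammer q n / INR (fact n).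

Definition kummerM1 (p q z : R) : R := PSeries (PS_derive (kummer_coef p q)) z.

Definition kummerM2 (p q z : R) : R :=
  PSeries (PS_derive (PS_derive (kummer_coef p q))) z.

Lemma pochhammer_pos (q : R) (n : nat) : 0 < q -> 0 < pochhammer q n.
Proof.
  intros Hq; induction n as [|n IH]; simpl; [lra|].
  apply Rmult_lt_0_compat; [exact IH|].
  pose proof (pos_INR n); lra.
Qed.

(** The coefficient recurrence is cleared of denominators so that it can be compared linearly with
    the coefficients of Kummer's equation. *)
Lemma kummer_coef_succ (p q : R) (n : nat) : 0 < q ->
  kummer_coef p q (S n) * (INR (S n) * (q + INR n)) =
  (p + INR n) * kummer_coef p q n.
Proof.
  intros Hq; unfold kummer_coef.
  rewrite fact_simpl, mult_INR; cbn [pochhammer].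
  pose proof (pochhammer_pos q n Hq).
  pose proof (INR_fact_neq_0 n).
  pose proof (pos_INR n).
  assert (INR (S n) <> 0) by (apply not_0_INR; discriminate).
  field; repeat split; lra.
Qed.

(** Each ratio [(p + n) / (q + n)] is at most [Rabs p / q + 1] in absolute value, so the Pochhammer
    quotient grows at most geometrically. *)
Lemma kummer_coef_bound (p q : R) (n : nat) : 0 < q ->
  Rabs (kummer_coef p q n) <= (Rabs p / q + 1) ^ n / INR (fact n).
Proof.
  intros Hq.
  pose proof (INR_fact_lt_0 n) as Hf.
  unfold kummer_coef, Rdiv at 1 3.
  rewrite Rabs_mult, (Rabs_pos_eq (/ _)) by (left; now apply Rinv_0_lt_compat).
  apply Rmult_le_compat_r; [left; now apply Rinv_0_lt_compat|].
  clear Hf; induction n as [|n IH].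
  - simpl; unfold Rdiv; rewrite Rinv_1, Rmult_1_l, Rabs_R1; lra.
  - cbn [pochhammer pow].
    pose proof (pochhammer_pos q n Hq) as Hpos.
    pose proof (pos_INR n) as Hn.
    replace (pochhammer p n * (p + INR n) / (pochhammer q n * (q + INR n)))
      with ((p + INR n) / (q + INR n) * (pochhammer p n / pochhammer q n))
      by (field; lra).
    rewrite Rabs_mult.
    apply Rmult_le_compat; try apply Rabs_pos; [|exact IH].
    unfold Rdiv at 1; rewrite Rabs_mult, (Rabs_pos_eq (/ _))
      by (left; apply Rinv_0_lt_compat; lra).
    apply Rle_div_l; [lra|].
    apply Rle_trans with (Rabs p + INR n).
    + eapply Rle_trans; [apply Rabs_triang|].
      rewrite (Rabs_pos_eq (INR n)) by exact Hn; lra.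
    + pose proof (Rabs_pos p) as Hp.
      assert (0 <= Rabs p / q) by (apply Rdiv_le_0_compat; lra).
      assert (Rabs p / q * q = Rabs p) by (field; lra).
      nra.
Qed.

Lemma CV_radius_kummer (p q : R) : 0 < q ->
  CV_radius (kummer_coef p q) = p_infty.
Proof.
  intros Hq.
  destruct (CV_radius_bounded (kummer_coef p q)) as [Hub _].
  assert (Hin : forall r : R, Rbar_le r (CV_radius (kummer_coef p q))).
  { intros r; apply Hub.
    set (x := (Rabs p / q + 1) * Rabs r).
    (* The sequence [x ^ n / n!] tends to 0, hence is bounded; this bounds the terms of the series
       at every radius [r]. *)
    destruct (maj_by_pos (fun n => x ^ n / INR (fact n))) as [M [_ HM]].
    { exists 0; apply cv_speed_pow_fact. }
    exists M; intros n.
    eapply Rle_trans; [|apply (HM n)].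
    eapply Rle_trans; [|apply Rle_abs].
    rewrite Rabs_mult, <- RPow_abs.
    unfold x; rewrite Rpow_mult_distr.
    replace ((Rabs p / q + 1) ^ n * Rabs r ^ n / INR (fact n))
      with ((Rabs p / q + 1) ^ n / INR (fact n) * Rabs r ^ n)
      by (field; apply INR_fact_neq_0).
    apply Rmult_le_compat_r; [apply pow_le, Rabs_pos|].
    now apply kummer_coef_bound. }
  destruct (CV_radius (kummer_coef p q)) as [c| |]; [|reflexivity|].
  - specialize (Hin (c + 1)); simpl in Hin; lra.
  - destruct (Hin 0).
Qed.

Lemma ex_pseries_kummer (p q z : R) : 0 < q ->
  ex_pseries (kummer_coef p q) z.
Proof.
  intros Hq; apply CV_radius_inside; now rewrite CV_radius_kummer.
Qed.

Lemma is_derive_kummerM (p q z : R) : 0 < q ->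
  is_derive (kummerM p q) z (kummerM1 p q z).
Proof.
  intros Hq; apply (is_derive_PSeries (kummer_coef p q)).
  now rewrite CV_radius_kummer.
Qed.

Lemma is_derive_kummerM1 (p q z : R) : 0 < q ->
  is_derive (kummerM1 p q) z (kummerM2 p q z).
Proof.
  intros Hq; apply is_derive_PSeries.
  now rewrite CV_radius_derive, CV_radius_kummer.
Qed.

Lemma kummerM_0 (p q : R) : kummerM p q 0 = 1.
Proof.
  unfold kummerM; rewrite PSeries_0; simpl; field.
Qed.

(** Comparing coefficients in [z M'' + q M' = z M' + p M] gives exactly the recurrence
    [kummer_coef_succ]. *)
Lemma kummer_equation (p q z : R) : 0 < q ->
  z * kummerM2 p q z + (q - z) * kummerM1 p q z - p * kummerM p q z = 0.
Proof.
  intros Hq.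
  set (c := kummer_coef p q).
  assert (E : forall b, CV_radius b = p_infty -> ex_pseries b z).
  { intros b Hb; apply CV_radius_inside; now rewrite Hb. }
  assert (Hc : CV_radius c = p_infty) by now apply CV_radius_kummer.
  assert (H1 : CV_radius (PS_derive c) = p_infty)
    by now rewrite CV_radius_derive.
  assert (H2 : CV_radius (PS_derive (PS_derive c)) = p_infty)
    by now rewrite !CV_radius_derive.
  change (z * PSeries (PS_derive (PS_derive c)) z
    + (q - z) * PSeries (PS_derive c) z - p * PSeries c z = 0).
  assert (L : PSeries (PS_plus (PS_incr_1 (PS_derive (PS_derive c)))
                         (PS_scal q (PS_derive c))) z
            = PSeries (PS_plus (PS_incr_1 (PS_derive c)) (PS_scal p c)) z).
  { apply PSeries_ext; intros n.
    pose proof (kummer_coef_succ p q n Hq) as Hs; fold c in Hs.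
    unfold PS_plus, PS_scal, PS_derive, scal, plus; simpl; unfold mult; simpl.
    (* Index 0 is separate: multiplication by [z] shifts the coefficients and puts a zero in
       front. *)
    destruct n as [|n]; simpl PS_incr_1; unfold zero; simpl in *; lra. }
  rewrite !PSeries_plus, !PSeries_incr_1, !PSeries_scal in L.
  - lra.
  - now apply ex_pseries_incr_1, E.
  - apply ex_pseries_scal; [apply Rmult_comm | now apply E].
  - now apply ex_pseries_incr_1, E.
  - apply ex_pseries_scal; [apply Rmult_comm | now apply E].
Qed.

(** For positive parameters all Taylor coefficients are nonnegative, so the series compare term by
    term. *)
Lemma kummerM_le (p q x y : R) : 0 < p -> 0 < q -> 0 <= x <= y ->
  kummerM p q x <= kummerM p q y.
Proof.
  intros Hp Hq Hxy; apply Series_le.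
  - intros n.
    assert (0 <= kummer_coef p q n).
    { unfold kummer_coef; left; repeat apply Rdiv_lt_0_compat;
        try now apply pochhammer_pos.
      apply INR_fact_lt_0. }
    split.
    + apply Rmult_le_pos; [assumption|]; apply pow_le; lra.
    + apply Rmult_le_compat_l; [assumption|]; now apply pow_incr.
  - apply ex_pseries_R; now apply (ex_pseries_kummer p q y).
Qed.

(** * Kummer functions of a squared argument *)

(** The sign [eps] covers two families at once: -1 gives the functions in the solution formula, 1
    those in the denominator of [f1]. *)
Definition even_kummer (eps p x : R) : R := kummerM p (1 / 2) (eps * x ^ 2).

Definition even_kummer1 (eps p x : R) : R :=
  2 * eps * x * kummerM1 p (1 / 2) (eps * x ^ 2).

Definition odd_kummer (eps p x : R) : R := x * kummerM p (3 / 2) (eps * x ^ 2).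

Definition odd_kummer1 (eps p x : R) : R :=
  kummerM p (3 / 2) (eps * x ^ 2)
  + 2 * eps * x ^ 2 * kummerM1 p (3 / 2) (eps * x ^ 2).

Lemma is_derive_kummerM_square (eps p q x : R) : 0 < q ->
  is_derive (fun y => kummerM p q (eps * y ^ 2)) x
    (2 * eps * x * kummerM1 p q (eps * x ^ 2)).
Proof.
  intros Hq.
  replace (2 * eps * x * kummerM1 p q (eps * x ^ 2))
    with (scal (2 * eps * x) (kummerM1 p q (eps * x ^ 2))) by reflexivity.
  apply (is_derive_comp (kummerM p q) (fun y => eps * y ^ 2)).
  - now apply is_derive_kummerM.
  - auto_derive; [exact I | ring].
Qed.

Lemma is_derive_kummerM1_square (eps p q x : R) : 0 < q ->
  is_derive (fun y => kummerM1 p q (eps * y ^ 2)) x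
    (2 * eps * x * kummerM2 p q (eps * x ^ 2)).
Proof.
  intros Hq.
  replace (2 * eps * x * kummerM2 p q (eps * x ^ 2))
    with (scal (2 * eps * x) (kummerM2 p q (eps * x ^ 2))) by reflexivity.
  apply (is_derive_comp (kummerM1 p q) (fun y => eps * y ^ 2)).
  - now apply is_derive_kummerM1.
  - auto_derive; [exact I | ring].
Qed.

Lemma is_derive_even_kummer (eps p x : R) :
  is_derive (even_kummer eps p) x (even_kummer1 eps p x).
Proof. apply is_derive_kummerM_square; lra. Qed.

Lemma is_derive_continuity_pt (f : R -> R) (x l : R) :
  is_derive f x l -> continuity_pt f x.
Proof.
  intros H; apply continuity_pt_filterlim.
  apply (ex_derive_continuous f x); now exists l.
Qed.

Lemma is_derive_mult_R (f g : R -> R) (x df dg l : R) :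
  is_derive f x df -> is_derive g x dg -> l = df * g x + f x * dg ->
  is_derive (fun y => f y * g y) x l.
Proof.
  intros Hf Hg ->; apply (is_derive_mult f g x df dg Hf Hg Rmult_comm).
Qed.

(** With [z = eps * x ^ 2] the second derivative is [4 eps (z M'' + M' / 2)]; Kummer's equation with
    [q = 1 / 2] turns the bracket into [z M' + p M]. *)
Lemma is_derive_even_kummer1 (eps p x : R) :
  is_derive (even_kummer1 eps p) x
    (2 * eps * x * even_kummer1 eps p x + 4 * eps * p * even_kummer eps p x).
Proof.
  unfold even_kummer1 at 1.
  eapply (is_derive_mult_R (fun y => 2 * eps * y)).
  - auto_derive; [exact I | reflexivity].
  - apply is_derive_kummerM1_square; lra.
  - pose proof (kummer_equation p (1 / 2) (eps * x ^ 2) ltac:(lra)) as K.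
    unfold even_kummer1, even_kummer.
    set (z := eps * x ^ 2) in *.
    transitivity (4 * eps * (z * kummerM2 p (1 / 2) z
      + 1 / 2 * kummerM1 p (1 / 2) z)).
    + replace (z * kummerM2 p (1 / 2) z) with
        (z * kummerM1 p (1 / 2) z + p * kummerM p (1 / 2) z
         - 1 / 2 * kummerM1 p (1 / 2) z) by lra.
      unfold z; field.
    + unfold z; field.
Qed.

Lemma is_derive_odd_kummer (eps p x : R) :
  is_derive (odd_kummer eps p) x (odd_kummer1 eps p x).
Proof.
  eapply (is_derive_mult_R (fun y => y)).
  - apply is_derive_id.
  - apply is_derive_kummerM_square; lra.
  - unfold odd_kummer1, one; simpl; ring.
Qed.

(** Here the second derivative is [4 eps x (z M'' + 3 / 2 M')], matching [q = 3 / 2]. The term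
    [- 2 eps] compensates for the summand [M] in [odd_kummer1]. *)
Lemma is_derive_odd_kummer1 (eps p x : R) :
  is_derive (odd_kummer1 eps p) x
    (2 * eps * x * odd_kummer1 eps p x
     + (4 * eps * p - 2 * eps) * odd_kummer eps p x).
Proof.
  replace (2 * eps * x * odd_kummer1 eps p x
     + (4 * eps * p - 2 * eps) * odd_kummer eps p x) with
    (2 * eps * x * kummerM1 p (3 / 2) (eps * x ^ 2) +
      (4 * eps * x * kummerM1 p (3 / 2) (eps * x ^ 2)
       + 2 * eps * x ^ 2 *
           (2 * eps * x * kummerM2 p (3 / 2) (eps * x ^ 2)))).
  - apply (is_derive_plus (fun y => kummerM p (3 / 2) (eps * y ^ 2))).
    + apply is_derive_kummerM_square; lra.
    + eapply (is_derive_mult_R (fun y => 2 * eps * y ^ 2)).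
      * auto_derive; [exact I | reflexivity].
      * apply is_derive_kummerM1_square; lra.
      * ring.
  - pose proof (kummer_equation p (3 / 2) (eps * x ^ 2) ltac:(lra)) as K.
    unfold odd_kummer1, odd_kummer.
    set (z := eps * x ^ 2) in *.
    transitivity (4 * eps * x * (z * kummerM2 p (3 / 2) z
      + 3 / 2 * kummerM1 p (3 / 2) z)).
    + unfold z; field.
    + replace (z * kummerM2 p (3 / 2) z) with
        (z * kummerM1 p (3 / 2) z + p * kummerM p (3 / 2) z
         - 3 / 2 * kummerM1 p (3 / 2) z) by lra.
      unfold z; field.
Qed.

(** * The similarity equation and its fundamental solutions *)

(* With [f1] playing the role of [f'], this is [f'' + 2 x f' - 2 alpha f = 0] on
   the open interval, with [f] and [f'] continuous up to the endpoints. *)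
Definition similarity_ode (alpha b : R) (f f1 : R -> R) : Prop :=
  (forall x, 0 <= x <= b -> continuity_pt f x /\ continuity_pt f1 x) /\
  (forall x, 0 < x < b ->
     is_derive f x (f1 x) /\
     is_derive f1 x (2 * alpha * f x - 2 * x * f1 x)).

Lemma similarity_ode_global (alpha b : R) (f f1 : R -> R) :
  (forall x : R, is_derive f x (f1 x)) ->
  (forall x : R, is_derive f1 x (2 * alpha * f x - 2 * x * f1 x)) ->
  similarity_ode alpha b f f1.
Proof.
  intros H H1; split; [|now split].
  intros x _; split; eapply is_derive_continuity_pt; auto.
Qed.

(** Abel's identity: [exp (y ^ 2)] times the Wronskian has zero derivative inside the interval, and
    continuity up to the endpoints lets the mean value theorem compare its values at 0 and [x]. *)
Lemma similarity_ode_wronskian (alpha b : R) (f f1 g g1 : R -> R) :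
  similarity_ode alpha b f f1 -> similarity_ode alpha b g g1 ->
  forall x, 0 <= x <= b ->
    f x * g1 x - f1 x * g x = exp (- x ^ 2) * (f 0 * g1 0 - f1 0 * g 0).
Proof.
  intros [Cf Df] [Cg Dg] x Hx.
  set (W := fun y => exp (y ^ 2) * (f y * g1 y - f1 y * g y)).
  destruct (MVT_gen W 0 x (fun _ => 0)) as [c [_ Hc]].
  - intros y Hy; rewrite Rmin_left, Rmax_right in Hy by lra.
    destruct (Df y) as [Hf Hf1]; [lra|].
    destruct (Dg y) as [Hg Hg1]; [lra|].
    unfold W; auto_derive.
    + repeat split; eexists; eassumption.
    + rewrite (is_derive_unique (fun x : R => f x) _ _ Hf).
      rewrite (is_derive_unique (fun x : R => f1 x) _ _ Hf1).
      rewrite (is_derive_unique (fun x : R => g x) _ _ Hg).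
      rewrite (is_derive_unique (fun x : R => g1 x) _ _ Hg1).
      ring.
  - intros y Hy; rewrite Rmin_left, Rmax_right in Hy by lra.
    destruct (Cf y) as [Hf Hf1]; [lra|].
    destruct (Cg y) as [Hg Hg1]; [lra|].
    unfold W; apply continuity_pt_mult.
    + eapply is_derive_continuity_pt.
      auto_derive; [exact I | reflexivity].
    + apply continuity_pt_minus; now apply continuity_pt_mult.
  - unfold W in Hc.
    replace (0 ^ 2) with 0 in Hc by ring; rewrite exp_0 in Hc.
    rewrite exp_Ropp.
    pose proof (exp_pos (x ^ 2)).
    apply Rmult_eq_reg_l with (exp (x ^ 2)); [|lra].
    rewrite <- Rmult_assoc, Rinv_r by lra; lra.
Qed.

Definition phi1 (alpha : R) : R -> R := even_kummer (-1) (- alpha / 2).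
Definition dphi1 (alpha : R) : R -> R := even_kummer1 (-1) (- alpha / 2).
Definition phi2 (alpha : R) : R -> R := odd_kummer (-1) (- alpha / 2 + 1 / 2).
Definition dphi2 (alpha : R) : R -> R := odd_kummer1 (-1) (- alpha / 2 + 1 / 2).

Lemma is_derive_phi1 (alpha x : R) : is_derive (phi1 alpha) x (dphi1 alpha x).
Proof. apply is_derive_even_kummer. Qed.

Lemma is_derive_phi2 (alpha x : R) : is_derive (phi2 alpha) x (dphi2 alpha x).
Proof. apply is_derive_odd_kummer. Qed.

Lemma is_derive_dphi1 (alpha x : R) :
  is_derive (dphi1 alpha) x (2 * alpha * phi1 alpha x - 2 * x * dphi1 alpha x).
Proof.
  replace (2 * alpha * phi1 alpha x - 2 * x * dphi1 alpha x) with
    (2 * -1 * x * dphi1 alpha x + 4 * -1 * (- alpha / 2) * phi1 alpha x)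
    by field.
  apply is_derive_even_kummer1.
Qed.

Lemma is_derive_dphi2 (alpha x : R) :
  is_derive (dphi2 alpha) x (2 * alpha * phi2 alpha x - 2 * x * dphi2 alpha x).
Proof.
  replace (2 * alpha * phi2 alpha x - 2 * x * dphi2 alpha x) with
    (2 * -1 * x * dphi2 alpha x
     + (4 * -1 * (- alpha / 2 + 1 / 2) - 2 * -1) * phi2 alpha x) by field.
  apply is_derive_odd_kummer1.
Qed.

Lemma similarity_ode_phi1 (alpha b : R) :
  similarity_ode alpha b (phi1 alpha) (dphi1 alpha).
Proof.
  apply similarity_ode_global; intros x;
    [apply is_derive_phi1 | apply is_derive_dphi1].
Qed.

Lemma similarity_ode_phi2 (alpha b : R) :
  similarity_ode alpha b (phi2 alpha) (dphi2 alpha).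
Proof.
  apply similarity_ode_global; intros x;
    [apply is_derive_phi2 | apply is_derive_dphi2].
Qed.

Lemma even_kummer_0 (eps p : R) : even_kummer eps p 0 = 1.
Proof.
  unfold even_kummer; replace (eps * 0 ^ 2) with 0 by ring.
  apply kummerM_0.
Qed.

Lemma even_kummer1_0 (eps p : R) : even_kummer1 eps p 0 = 0.
Proof. unfold even_kummer1; ring. Qed.

Lemma odd_kummer_0 (eps p : R) : odd_kummer eps p 0 = 0.
Proof. unfold odd_kummer; ring. Qed.

Lemma odd_kummer1_0 (eps p : R) : odd_kummer1 eps p 0 = 1.
Proof.
  unfold odd_kummer1; replace (eps * 0 ^ 2) with 0 by ring.
  rewrite kummerM_0; ring.
Qed.

Lemma phi_wronskian (alpha x : R) : 0 <= x ->
  phi1 alpha x * dphi2 alpha x - dphi1 alpha x * phi2 alpha x = exp (- x ^ 2).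
Proof.
  intros Hx.
  rewrite (similarity_ode_wronskian alpha x _ _ _ _
    (similarity_ode_phi1 alpha x) (similarity_ode_phi2 alpha x)) by lra.
  unfold phi1, dphi1, phi2, dphi2.
  rewrite even_kummer_0, even_kummer1_0, odd_kummer_0, odd_kummer1_0; ring.
Qed.

(* The Wronskians of [f] against [phi1] and [phi2] are known, and [f] is
   recovered from them by Cramer's rule. *)
Lemma similarity_ode_solution (alpha b : R) (f f1 : R -> R) :
  similarity_ode alpha b f f1 ->
  forall x, 0 <= x <= b ->
    f x = f 0 * phi1 alpha x + f1 0 * phi2 alpha x /\
    f1 x = f 0 * dphi1 alpha x + f1 0 * dphi2 alpha x.
Proof.
  intros Hf x Hx.
  pose proof (similarity_ode_wronskian _ _ _ _ _ _ Hf
    (similarity_ode_phi1 alpha b) x Hx) as W1.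
  pose proof (similarity_ode_wronskian _ _ _ _ _ _ Hf
    (similarity_ode_phi2 alpha b) x Hx) as W2.
  pose proof (phi_wronskian alpha x (proj1 Hx)) as W.
  unfold phi1, dphi1, phi2, dphi2 in W1, W2.
  rewrite even_kummer_0, even_kummer1_0 in W1.
  rewrite odd_kummer_0, odd_kummer1_0 in W2.
  fold (phi1 alpha) (dphi1 alpha) in W1.
  fold (phi2 alpha) (dphi2 alpha) in W2.
  pose proof (exp_pos (- x ^ 2)).
  set (E := exp (- x ^ 2)) in *.
  assert (F1 : E * f1 0 = f1 x * phi1 alpha x - f x * dphi1 alpha x) by lra.
  assert (F0 : E * f 0 = f x * dphi2 alpha x - f1 x * phi2 alpha x) by lra.
  split; apply Rmult_eq_reg_l with E; try lra.
  - transitivity (E * f 0 * phi1 alpha x + E * f1 0 * phi2 alpha x);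
      [rewrite F0, F1, <- W|]; ring.
  - transitivity (E * f 0 * dphi1 alpha x + E * f1 0 * dphi2 alpha x);
      [rewrite F0, F1, <- W|]; ring.
Qed.

(** * Kummer's transformation *)

(** The equation assumed for [P] is that of the even and odd functions with [eps = 1] and parameters
    [alpha / 2 + 1 / 2] and [alpha / 2 + 1]; the Gaussian factor turns it into the similarity
    equation. *)
Lemma similarity_ode_exp (alpha b : R) (P P1 : R -> R) :
  (forall x : R, is_derive P x (P1 x)) ->
  (forall x : R, is_derive P1 x (2 * x * P1 x + (2 * alpha + 2) * P x)) ->
  similarity_ode alpha b (fun x => exp (- x ^ 2) * P x)
    (fun x => exp (- x ^ 2) * (P1 x - 2 * x * P x)).
Proof.
  intros H H1; apply similarity_ode_global; intros x; auto_derive;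
    try (repeat split; eexists; eauto).
  - rewrite (is_derive_unique (fun x : R => P x) _ _ (H x)).
    change (x * (x * 1)) with (x ^ 2); ring.
  - rewrite (is_derive_unique (fun x : R => P x) _ _ (H x)).
    rewrite (is_derive_unique (fun x : R => P1 x) _ _ (H1 x)).
    change (x * (x * 1)) with (x ^ 2); ring.
Qed.

(** The Gaussian has value 1 and slope 0 at 0, so the product keeps the Cauchy data of [P], which
    determine it. *)
Lemma kummer_transform (alpha x : R) (P P1 : R -> R) :
  (forall x : R, is_derive P x (P1 x)) ->
  (forall x : R, is_derive P1 x (2 * x * P1 x + (2 * alpha + 2) * P x)) ->
  0 <= x ->
  exp (- x ^ 2) * P x = P 0 * phi1 alpha x + P1 0 * phi2 alpha x.
Proof.
  intros H H1 Hx.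
  destruct (similarity_ode_solution alpha x _ _
    (similarity_ode_exp alpha x P P1 H H1) x) as [E _]; [lra|].
  cbv beta in E; rewrite E.
  replace (- 0 ^ 2) with 0 by ring; rewrite exp_0; ring.
Qed.

Lemma kummer_transform_even (alpha x : R) : 0 <= x ->
  phi1 alpha x = exp (- x ^ 2) * even_kummer 1 (alpha / 2 + 1 / 2) x.
Proof.
  intros Hx.
  rewrite (kummer_transform alpha x _ (even_kummer1 1 (alpha / 2 + 1 / 2)));
    [| intros y; apply is_derive_even_kummer | intros y | exact Hx].
  - rewrite even_kummer_0, even_kummer1_0; ring.
  - replace (2 * y * even_kummer1 1 (alpha / 2 + 1 / 2) y) with
      (2 * 1 * y * even_kummer1 1 (alpha / 2 + 1 / 2) y) by ring.
    replace (2 * alpha + 2) with (4 * 1 * (alpha / 2 + 1 / 2)) by field.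
    apply is_derive_even_kummer1.
Qed.

Lemma kummer_transform_odd (alpha x : R) : 0 <= x ->
  phi2 alpha x = exp (- x ^ 2) * odd_kummer 1 (alpha / 2 + 1) x.
Proof.
  intros Hx.
  rewrite (kummer_transform alpha x _ (odd_kummer1 1 (alpha / 2 + 1)));
    [| intros y; apply is_derive_odd_kummer | intros y | exact Hx].
  - rewrite odd_kummer_0, odd_kummer1_0; ring.
  - replace (2 * y * odd_kummer1 1 (alpha / 2 + 1) y) with
      (2 * 1 * y * odd_kummer1 1 (alpha / 2 + 1) y) by ring.
    replace (2 * alpha + 2) with (4 * 1 * (alpha / 2 + 1) - 2 * 1) by field.
    apply is_derive_odd_kummer1.
Qed.

(** * Monotonicity and the scalar equation for the free boundary coefficient *)

Lemma even_kummer_le (p x y : R) : 0 < p -> 0 <= x <= y ->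
  even_kummer 1 p x <= even_kummer 1 p y.
Proof.
  intros Hp Hxy; apply kummerM_le; [lra | lra |].
  rewrite !Rmult_1_l; split; [apply pow2_ge_0 | now apply pow_incr].
Qed.

Lemma odd_kummer_le (p x y : R) : 0 < p -> 0 <= x <= y ->
  odd_kummer 1 p x <= odd_kummer 1 p y.
Proof.
  intros Hp Hxy; unfold odd_kummer; rewrite !Rmult_1_l.
  pose proof (pow_incr x y 2 Hxy); pose proof (pow2_ge_0 x).
  apply Rmult_le_compat; [lra | | lra |].
  - apply Rle_trans with 1; [lra|].
    rewrite <- (kummerM_0 p (3 / 2)); apply kummerM_le; lra.
  - apply kummerM_le; lra.
Qed.

(* Substituting [z = exp w] turns the equation into one between functions that
   are continuous on the whole line ([Rpower] is discontinuous at [0]). *)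
Lemma exists_unique_power_balance (C m : R) (D : R -> R) :
  0 < C -> 0 < m -> (forall z, continuity_pt D z) -> 0 < D 0 ->
  (forall x y, 0 <= x <= y -> D x <= D y) ->
  exists! z, 0 < z /\ C * (1 / D z) = Rpower z m.
Proof.
  intros HC Hm Dc HD0 Dle.
  assert (Dpos : forall z, 0 <= z -> 0 < D z).
  { intros z Hz; apply Rlt_le_trans with (1 := HD0), Dle; lra. }
  assert (Eq : forall z, 0 < z ->
    (C * (1 / D z) = Rpower z m <-> Rpower z m * D z = C)).
  { intros z Hz; specialize (Dpos z (Rlt_le _ _ Hz)); split; intros H.
    - rewrite <- H; field; lra.
    - rewrite <- H; field; lra. }
  set (h := fun w => exp (m * w) * D (exp w)).
  assert (Hh : continuity h).
  { intros w; unfold h; apply continuity_pt_mult.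
    - eapply is_derive_continuity_pt; auto_derive; [exact I | reflexivity].
    - apply (continuity_pt_comp exp D); [|apply Dc].
      apply derivable_continuous_pt, derivable_pt_exp. }
  (* The bracket replaces [D] by constants: for [w <= 0] one has [D (exp w) <= D 1], so [w0] gives a
     value at most [C]; and [D >= D 0] makes the value at [w1] at least [C]. *)
  set (w0 := Rmin 0 (ln (C / D 1) / m)).
  set (w1 := ln (C / D 0) / m).
  assert (D1 : 0 < D 1) by (apply Dpos; lra).
  assert (H0 : h w0 <= C).
  { unfold h; apply Rle_trans with (C / D 1 * D 1); [|right; field; lra].
    apply Rmult_le_compat; [left; apply exp_pos | left; apply Dpos | |].
    - left; apply exp_pos.
    - rewrite <- (exp_ln (C / D 1)) by now apply Rdiv_lt_0_compat.
      replace (ln (C / D 1)) with (m * (ln (C / D 1) / m)) by (field; lra).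
      destruct (Rle_lt_or_eq_dec w0 (ln (C / D 1) / m) (Rmin_r _ _)) as [H|H].
      + left; apply exp_increasing, Rmult_lt_compat_l; assumption.
      + rewrite <- H; right; reflexivity.
    - apply Dle; split; [left; apply exp_pos|].
      rewrite <- exp_0.
      destruct (Rle_lt_or_eq_dec w0 0 (Rmin_l _ _)) as [H|H].
      + left; now apply exp_increasing.
      + rewrite H; right; reflexivity. }
  assert (H1 : C <= h w1).
  { unfold h, w1.
    replace (m * (ln (C / D 0) / m)) with (ln (C / D 0)) by (field; lra).
    rewrite exp_ln by now apply Rdiv_lt_0_compat.
    apply Rle_trans with (C / D 0 * D 0); [right; field; lra|].
    apply Rmult_le_compat_l; [left; now apply Rdiv_lt_0_compat|].
    apply Dle; split; [lra | left; apply exp_pos]. }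
  destruct (IVT_gen h w0 w1 C Hh) as [w [_ Hw]].
  { rewrite Rmin_left, Rmax_right by lra; lra. }
  exists (exp w); split.
  - split; [apply exp_pos|]; apply Eq; [apply exp_pos|].
    unfold Rpower; rewrite ln_exp; exact Hw.
  (* Uniqueness: the power increases strictly and the positive factor [D] does not decrease. *)
  - assert (Hlt : forall x y, 0 < x -> x < y ->
      Rpower x m * D x < Rpower y m * D y).
    { intros x y Hx Hxy.
      apply Rlt_le_trans with (Rpower y m * D x).
      - apply Rmult_lt_compat_r; [apply Dpos; lra|].
        apply Rlt_Rpower_l; lra.
      - apply Rmult_le_compat_l; [left; apply exp_pos | apply Dle; lra]. }
    intros y [Hy E]; apply Eq in E; [|exact Hy].
    assert (Ew : Rpower (exp w) m * D (exp w) = C)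
      by (unfold Rpower; rewrite ln_exp; exact Hw).
    destruct (Rtotal_order (exp w) y) as [H|[H|H]]; [|exact H|].
    + specialize (Hlt _ _ (exp_pos w) H); lra.
    + specialize (Hlt _ _ Hy H); lra.
Qed.

(** * Derivatives relative to a closed interval *)

Lemma is_derive_on_of_is_derive (f : R -> R) (D : R -> Prop) (x l : R) :
  is_derive f x l -> is_derive_on f D x l.
Proof.
  intros H; apply is_derive_Reals in H.
  apply (derivable_pt_lim_D_in f (fun _ => l) x) in H.
  intros e He; destruct (H e He) as [d [Hd Hy]].
  exists d; split; [exact Hd|]; intros y [[_ Hne] Hdist].
  apply Hy; split; [split; [exact I | exact Hne] | exact Hdist].
Qed.

Lemma is_derive_of_is_derive_on (f : R -> R) (lo hi x l : R) :
  lo < x < hi -> is_derive_on f (cc_interval lo hi) x l -> is_derive f x l.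
Proof.
  intros Hx H; apply is_derive_Reals.
  apply (derivable_pt_lim_D_in f (fun _ => l) x).
  intros e He; destruct (H e He) as [d [Hd Hy]].
  (* The radius is shrunk so that all points considered stay inside the interval. *)
  exists (Rmin d (Rmin (x - lo) (hi - x))); split.
  { repeat apply Rmin_pos; lra. }
  intros y [[_ Hne] Hdist]; apply Hy.
  assert (Hm : Rabs (y - x) < Rmin d (Rmin (x - lo) (hi - x))) by exact Hdist.
  apply Rmin_Rgt in Hm; destruct Hm as [Hm Hm'].
  apply Rmin_Rgt in Hm'; destruct Hm' as [Hm1 Hm2].
  apply Rgt_lt, Rabs_def2 in Hm1; apply Rgt_lt, Rabs_def2 in Hm2.
  split; [split; [split; lra | exact Hne] | exact Hm].
Qed.

(** Every point of a nondegenerate interval is a limit point of it: it is approached from the right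
    if [x < hi], from the left otherwise. *)
Lemma is_derive_on_unique (f : R -> R) (lo hi x l l' : R) :
  lo < hi -> lo <= x <= hi ->
  is_derive_on f (cc_interval lo hi) x l ->
  is_derive_on f (cc_interval lo hi) x l' -> l = l'.
Proof.
  intros Hlt Hx H H'.
  refine (single_limit _ _ _ _ x _ H H').
  intros d Hd.
  destruct (Rlt_or_le x hi) as [Hhi|Hhi].
  - pose proof (Rmin_l (d / 2) (hi - x)); pose proof (Rmin_r (d / 2) (hi - x)).
    assert (0 < Rmin (d / 2) (hi - x)) by (apply Rmin_pos; lra).
    exists (x + Rmin (d / 2) (hi - x)); unfold D_x, cc_interval, Rdist.
    repeat split; try lra.
    rewrite Rabs_pos_eq; lra.
  - pose proof (Rmin_l (d / 2) (x - lo)); pose proof (Rmin_r (d / 2) (x - lo)).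
    assert (0 < Rmin (d / 2) (x - lo)) by (apply Rmin_pos; lra).
    exists (x - Rmin (d / 2) (x - lo)); unfold D_x, cc_interval, Rdist.
    repeat split; try lra.
    rewrite Rabs_left; lra.
Qed.

(** The chain rule for an affine rescaling, valid at the endpoints too; it transfers derivatives of
    the profile to [[0, s t]]. *)
Lemma is_derive_on_scale (f g : R -> R) (T c b b' x l : R) :
  0 < c -> b = c * b' -> 0 <= x <= b' ->
  (forall y, 0 <= y <= b' -> g y = T * f (c * y)) ->
  is_derive_on f (cc_interval 0 b) (c * x) l ->
  is_derive_on g (cc_interval 0 b') x (T * c * l).
Proof.
  intros Hc -> Hx Hg H e He.
  pose proof (Rabs_pos (T * c)) as HT.
  (* Adding 1 keeps the divisor positive even when [T] vanishes. *)
  destruct (H (e / (Rabs (T * c) + 1))) as [d [Hd Hy]].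
  { apply Rdiv_lt_0_compat; lra. }
  exists (d / c); split; [now apply Rdiv_lt_0_compat|].
  intros y [[[Hy0 Hyb] Hne] Hdist].
  simpl in *; unfold Rdist in *.
  specialize (Hy (c * y)).
  rewrite (Hg y), (Hg x) by lra.
  assert (Hquot : (T * f (c * y) - T * f (c * x)) / (y - x) - T * c * l
    = T * c * ((f (c * y) - f (c * x)) / (c * y - c * x) - l)).
  { field; split; [|lra].
    replace (c * y - c * x) with (c * (y - x)) by ring.
    apply Rmult_integral_contrapositive; split; lra. }
  rewrite Hquot, Rabs_mult.
  assert (Hs : Rabs ((f (c * y) - f (c * x)) / (c * y - c * x) - l)
    < e / (Rabs (T * c) + 1)).
  { apply Hy; split; [split; [split|]|].
    - apply Rmult_le_pos; lra.
    - apply Rmult_le_compat_l; lra.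
    - intros E; apply Hne, Rmult_eq_reg_l with c; lra.
    - replace (c * y - c * x) with (c * (y - x)) by ring.
      rewrite Rabs_mult, Rabs_pos_eq by lra.
      apply (Rmult_lt_compat_l c) in Hdist; [|exact Hc].
      replace (c * (d / c)) with d in Hdist by (field; lra).
      exact Hdist. }
  apply Rle_lt_trans with (Rabs (T * c) * (e / (Rabs (T * c) + 1))).
  - apply Rmult_le_compat_l; lra.
  - apply Rlt_le_trans with ((Rabs (T * c) + 1) * (e / (Rabs (T * c) + 1))).
    + apply Rmult_lt_compat_r; [apply Rdiv_lt_0_compat|]; lra.
    + right; field; lra.
Qed.

(* Composing with [clamp b] makes a function that is only controlled on [0, b]
   continuous across the endpoints, as the mean value theorem requires. *)
Definition clamp (b x : R) : R := Rmax 0 (Rmin b x).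

Lemma clamp_id (b x : R) : 0 <= x <= b -> clamp b x = x.
Proof. intros H; unfold clamp; rewrite Rmin_right, Rmax_right; lra. Qed.

Lemma clamp_bounds (b x : R) : 0 <= b -> 0 <= clamp b x <= b.
Proof.
  intros H; unfold clamp, Rmax, Rmin.
  destruct (Rle_dec b x), (Rle_dec 0 _); lra.
Qed.

Lemma clamp_near (b x y : R) : 0 <= x <= b ->
  Rabs (clamp b y - x) <= Rabs (y - x).
Proof.
  intros H; unfold clamp, Rmax, Rmin, Rabs.
  destruct (Rle_dec b y), (Rle_dec 0 _), (Rcase_abs (y - x));
    try destruct (Rcase_abs _); lra.
Qed.

Lemma continuity_pt_clamp (f : R -> R) (b x : R) : 0 <= x <= b ->
  continue_in f (cc_interval 0 b) x -> continuity_pt (fun y => f (clamp b y)) x.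
Proof.
  intros Hx Hf e He; destruct (Hf e He) as [d [Hd Hy]].
  exists d; split; [exact Hd|]; intros y [_ Hdist].
  rewrite (clamp_id b x) by exact Hx.
  (* [continue_in] only speaks of points other than [x], whereas clamping may send [y] to [x]
     itself. Otherwise the same [d] serves, clamping being nonexpansive. *)
  destruct (Req_dec x (clamp b y)) as [E|Hne].
  - rewrite <- E; simpl; unfold Rdist; rewrite Rminus_diag, Rabs_R0; exact He.
  - apply Hy; split; [split; [apply clamp_bounds; lra | exact Hne]|].
    simpl in *; unfold Rdist in *.
    eapply Rle_lt_trans; [apply clamp_near; exact Hx | exact Hdist].
Qed.

Lemma is_derive_clamp (f : R -> R) (b x l : R) : 0 < x < b ->
  is_derive f x l -> is_derive (fun y => f (clamp b y)) x l.
Proof.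
  intros Hx H; apply (is_derive_ext_loc f); [|exact H].
  apply (locally_interval _ x 0 b); [apply Hx | apply Hx |].
  intros y Hy0 Hyb; rewrite clamp_id; [reflexivity|]; simpl in *; lra.
Qed.

(** * Passage to the similarity variable *)

Lemma sqrt_exp (x : R) : sqrt (exp x) = exp (x / 2).
Proof.
  apply sqrt_lem_1; [left; apply exp_pos | left; apply exp_pos |].
  rewrite <- exp_plus; f_equal; field.
Qed.

(** The powers of [t] combine to [t^((beta - delta) / 2)] over [sqrt t], the same time factor as in
    the flux; this is why [alpha = beta - delta] makes the Stefan condition independent of time. *)
Lemma stefan_power (a xi t beta delta : R) : 0 < a -> 0 < xi -> 0 < t ->
  Rpower (2 * xi * a * sqrt t) beta * Rpower (xi * a / sqrt t) delta
    * (xi * a / sqrt t)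
  = Rpower t ((beta - delta) / 2) * (1 / (2 * a * sqrt t))
    * (Rpower 2 (beta + 1) * Rpower a (beta + delta + 2)
       * Rpower xi (beta + delta + 1)).
Proof.
  intros Ha Hxi Ht.
  assert (E2 : exp (ln 2) = 2) by (apply exp_ln; lra).
  rewrite <- (exp_ln a), <- (exp_ln xi), <- (exp_ln t) by assumption.
  generalize dependent (ln 2); generalize (ln a) (ln xi) (ln t).
  clear; intros A X T L E2.
  (* Only the bases 2 become exponentials; the numerals 2 in the exponents must stay, so that
     comparing exponents is linear in the logarithms. *)
  replace (Rpower 2 (beta + 1)) with (Rpower (exp L) (beta + 1))
    by (now rewrite E2).
  replace (2 * exp X) with (exp L * exp X) by (now rewrite E2).
  replace (2 * exp A) with (exp L * exp A) by (now rewrite E2).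
  clear E2; rewrite sqrt_exp; unfold Rdiv; rewrite Rmult_1_l.
  rewrite <- !exp_plus, <- !exp_Ropp, <- !exp_plus.
  unfold Rpower; rewrite !ln_exp, <- !exp_plus; f_equal; field.
Qed.

Lemma similarity_variable (a xi x t : R) : 0 < a -> 0 < t ->
  0 < x < 2 * xi * a * sqrt t -> 0 < x / (2 * a * sqrt t) < xi.
Proof.
  intros Ha Ht Hx; pose proof (sqrt_lt_R0 t Ht).
  assert (0 < 2 * a * sqrt t) by (repeat apply Rmult_lt_0_compat; lra).
  split; [apply Rdiv_lt_0_compat; lra|].
  apply Rlt_div_l; lra.
Qed.

Section Similarity.

Variables (a alpha xi : R) (phi f1 f2 : R -> R) (u : R -> R -> R) (s : R -> R).
Hypothesis a_pos : 0 < a.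
Hypothesis xi_pos : 0 < xi.
Hypothesis s_def : forall t, 0 < t -> s t = 2 * xi * a * sqrt t.
Hypothesis u_def : forall x t, 0 < t -> 0 <= x <= s t ->
  u x t = Rpower t (alpha / 2) * phi (x / (2 * a * sqrt t)).
Hypothesis phi_C2 : forall x, cc_interval 0 xi x ->
  is_derive_on phi (cc_interval 0 xi) x (f1 x) /\
  is_derive_on f1 (cc_interval 0 xi) x (f2 x) /\
  continue_in f2 (cc_interval 0 xi) x.

Lemma scale_pos (t : R) : 0 < t -> 0 < 2 * a * sqrt t.
Proof.
  intros Ht; pose proof (sqrt_lt_R0 t Ht).
  repeat apply Rmult_lt_0_compat; lra.
Qed.

Lemma free_boundary_pos (t : R) : 0 < t -> 0 < s t.
Proof.
  intros Ht; rewrite s_def by exact Ht.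
  pose proof (scale_pos t Ht).
  replace (2 * xi * a * sqrt t) with (xi * (2 * a * sqrt t)) by ring.
  now apply Rmult_lt_0_compat.
Qed.

Lemma is_derive_profile (x : R) : 0 < x < xi -> is_derive phi x (f1 x).
Proof.
  intros Hx; apply (is_derive_of_is_derive_on _ 0 xi); [exact Hx|].
  apply phi_C2; unfold cc_interval; lra.
Qed.

Lemma is_derive_profile1 (x : R) : 0 < x < xi -> is_derive f1 x (f2 x).
Proof.
  intros Hx; apply (is_derive_of_is_derive_on _ 0 xi); [exact Hx|].
  apply phi_C2; unfold cc_interval; lra.
Qed.

Lemma is_derive_similarity_x (x t : R) : 0 < t -> 0 < x < s t ->
  is_derive (fun y : R => u y t) x
    (Rpower t (alpha / 2) / (2 * a * sqrt t) * f1 (x / (2 * a * sqrt t))).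
Proof.
  intros Ht Hx; pose proof (scale_pos t Ht).
  apply (is_derive_ext_loc
    (fun y => Rpower t (alpha / 2) * phi (y / (2 * a * sqrt t)))).
  - apply (locally_interval _ x 0 (s t)); [apply Hx | apply Hx |].
    intros y Hy0 Hyb; symmetry; apply u_def; simpl in *; lra.
  - rewrite s_def in Hx by exact Ht.
    pose proof (is_derive_profile _ (similarity_variable a xi x t a_pos Ht Hx))
      as Hphi.
    set (c := 2 * a * sqrt t) in *.
    auto_derive.
    + eexists; exact Hphi.
    + change (x * / c) with (x / c).
      rewrite (is_derive_unique (fun y : R => phi y) _ _ Hphi); field; lra.
Qed.

Lemma is_derive_n_similarity_x (x t : R) : 0 < t -> 0 < x < s t ->
  is_derive_n (fun y : R => u y t) 2 x
    (Rpower t (alpha / 2) / (2 * a * sqrt t) ^ 2 * f2 (x / (2 * a * sqrt t))).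
Proof.
  intros Ht Hx; pose proof (scale_pos t Ht).
  change (is_derive (Derive (fun y => u y t)) x
    (Rpower t (alpha / 2) / (2 * a * sqrt t) ^ 2 * f2 (x / (2 * a * sqrt t)))).
  apply (is_derive_ext_loc (fun y =>
    Rpower t (alpha / 2) / (2 * a * sqrt t) * f1 (y / (2 * a * sqrt t)))).
  - apply (locally_interval _ x 0 (s t)); [apply Hx | apply Hx |].
    intros y Hy0 Hyb; symmetry; apply is_derive_unique.
    apply is_derive_similarity_x; [exact Ht | simpl in *; lra].
  - rewrite s_def in Hx by exact Ht.
    pose proof (is_derive_profile1 _ (similarity_variable a xi x t a_pos Ht Hx))
      as Hphi.
    set (c := 2 * a * sqrt t) in *.
    auto_derive.
    + eexists; exact Hphi.
    + change (x * / c) with (x / c).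
      rewrite (is_derive_unique (fun y : R => f1 y) _ _ Hphi); field; lra.
Qed.

Lemma is_derive_similarity_t (x t : R) : 0 < t -> 0 < x < s t ->
  is_derive (fun tau : R => u x tau) t
    (Rpower t (alpha / 2) / (2 * t)
     * (alpha * phi (x / (2 * a * sqrt t))
        - x / (2 * a * sqrt t) * f1 (x / (2 * a * sqrt t)))).
Proof.
  intros Ht Hx; pose proof (scale_pos t Ht).
  rewrite s_def in Hx by exact Ht.
  pose proof (sqrt_lt_R0 t Ht) as Hst.
  apply (is_derive_ext_loc
    (fun tau => Rpower tau (alpha / 2) * phi (x / (2 * a * sqrt tau)))).
  (* For fixed [x] the point lies in the domain once [tau] is at least [(x / (2 * xi * a)) ^ 2];
     this is below [t], so the similarity formula holds near [t]. *)
  - assert (Hlt : (x / (2 * xi * a)) ^ 2 < t).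
    { rewrite <- (sqrt_sqrt t) by lra.
      assert (0 <= x / (2 * xi * a) < sqrt t).
      { assert (0 < 2 * xi * a) by (repeat apply Rmult_lt_0_compat; lra).
        split; [apply Rdiv_le_0_compat; lra|].
        apply Rlt_div_l; lra. }
      nra. }
    pose proof (pow2_ge_0 (x / (2 * xi * a))).
    apply (locally_interval _ t ((x / (2 * xi * a)) ^ 2) p_infty);
      [exact Hlt | exact I |].
    intros tau Htau _; simpl in Htau; symmetry.
    assert (Htau0 : 0 < tau) by (simpl in *; lra).
    apply u_def; [exact Htau0|]; rewrite s_def by exact Htau0.
    split; [lra|].
    assert (Hxi : 0 < 2 * xi * a) by (repeat apply Rmult_lt_0_compat; lra).
    replace x with (2 * xi * a * (x / (2 * xi * a))) at 1 by (field; lra).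
    apply Rmult_le_compat_l; [lra|].
    rewrite <- (sqrt_pow2 (x / (2 * xi * a))).
    + apply sqrt_le_1_alt; simpl; lra.
    + apply Rdiv_le_0_compat; lra.
  - pose proof (is_derive_profile _ (similarity_variable a xi x t a_pos Ht Hx))
      as Hphi.
    unfold Rpower; auto_derive.
    + repeat split; try lra; eexists; exact Hphi.
    + change (x * / (2 * a * sqrt t)) with (x / (2 * a * sqrt t)).
      rewrite (is_derive_unique (fun y : R => phi y) _ _ Hphi).
      generalize (f1 (x / (2 * a * sqrt t))) (phi (x / (2 * a * sqrt t)))
        (exp (alpha / 2 * ln t)); intros F1 F E.
      (* With [r = sqrt t] as variable the identity becomes rational. *)
      assert (Et : t = sqrt t * sqrt t) by (rewrite sqrt_sqrt; lra).
      set (r := sqrt t) in *; clearbody r; rewrite Et; field; lra.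
Qed.

(** Both sides of the heat equation carry the factor [t^(alpha / 2) / t], so one time already yields
    the profile equation, which in turn gives all times. *)
Lemma heat_equation_iff :
  (forall x t, 0 < t -> 0 < x < s t ->
     ex_derive (fun tau => u x tau) t /\
     ex_derive (fun y => u y t) x /\
     ex_derive_n (fun y => u y t) 2 x /\
     Derive (fun tau => u x tau) t = a ^ 2 * Derive_n (fun y => u y t) 2 x)
  <-> (forall x, 0 < x < xi -> f2 x = 2 * alpha * phi x - 2 * x * f1 x).
Proof.
  split.
  - intros H x Hx.
    (* At time 1 the point [2 * a * x] has similarity variable [x]. *)
    assert (Hx1 : 0 < 2 * a * x < s 1).
    { rewrite s_def, sqrt_1 by lra.
      split; [repeat apply Rmult_lt_0_compat; lra | nra]. }
    destruct (H (2 * a * x) 1 Rlt_0_1 Hx1) as (_ & _ & _ & E).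
    rewrite (is_derive_unique _ _ _ (is_derive_similarity_t _ _ Rlt_0_1 Hx1))
      in E.
    rewrite (is_derive_n_unique _ _ _ _
      (is_derive_n_similarity_x _ _ Rlt_0_1 Hx1)) in E.
    rewrite sqrt_1 in E.
    replace (2 * a * x / (2 * a * 1)) with x in E by (field; lra).
    unfold Rpower in E; rewrite ln_1, Rmult_0_r, exp_0 in E.
    assert (a ^ 2 * (1 / (2 * a * 1) ^ 2 * f2 x) = f2 x / 4) by (field; lra).
    lra.
  - intros H x t Ht Hx.
    pose proof (is_derive_similarity_t _ _ Ht Hx) as Dt.
    pose proof (is_derive_similarity_x _ _ Ht Hx) as Dx.
    pose proof (is_derive_n_similarity_x _ _ Ht Hx) as Dxx.
    repeat split; [now exists (Rpower t (alpha / 2) / (2 * t)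
     * (alpha * phi (x / (2 * a * sqrt t))
        - x / (2 * a * sqrt t) * f1 (x / (2 * a * sqrt t)))) | | |].
    + eexists; exact Dx.
    + eexists; exact Dxx.
    + rewrite (is_derive_unique _ _ _ Dt), (is_derive_n_unique _ _ _ _ Dxx).
      rewrite s_def in Hx by exact Ht.
      rewrite (H _ (similarity_variable a xi x t a_pos Ht Hx)).
      pose proof (sqrt_lt_R0 t Ht).
      generalize (f1 (x / (2 * a * sqrt t))) (phi (x / (2 * a * sqrt t)))
        (Rpower t (alpha / 2)); intros F1 F E.
      assert (Et : t = sqrt t * sqrt t) by (rewrite sqrt_sqrt; lra).
      set (r := sqrt t) in *; clearbody r; rewrite Et; field; lra.
Qed.

Lemma similarity_boundary_value (t : R) : 0 < t ->
  u (s t) t = Rpower t (alpha / 2) * phi xi.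
Proof.
  intros Ht; pose proof (free_boundary_pos t Ht); pose proof (scale_pos t Ht).
  rewrite u_def by lra; f_equal; f_equal; rewrite s_def by exact Ht.
  pose proof (sqrt_lt_R0 t Ht); field; lra.
Qed.

(** Existence comes from rescaling, uniqueness from [is_derive_on_unique]; so the fluxes quantified
    existentially in [robin_problem] have a known value at [x = 0] and [x = xi]. *)
Lemma similarity_boundary_derive (x ux t : R) : 0 < t -> 0 <= x <= xi ->
  is_derive_on (fun y => u y t) (cc_interval 0 (s t)) (2 * a * sqrt t * x) ux
  <-> ux = Rpower t (alpha / 2) * (1 / (2 * a * sqrt t)) * f1 x.
Proof.
  intros Ht Hx.
  pose proof (free_boundary_pos t Ht) as Hs; pose proof (scale_pos t Ht) as Hc.
  set (c := 2 * a * sqrt t) in *.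
  assert (Es : s t = c * xi) by (rewrite s_def by exact Ht; unfold c; ring).
  assert (Hcx : 0 <= c * x <= s t).
  { rewrite Es; split; [apply Rmult_le_pos | apply Rmult_le_compat_l]; lra. }
  assert (H : is_derive_on (fun y => u y t) (cc_interval 0 (s t)) (c * x)
    (Rpower t (alpha / 2) * (1 / c) * f1 x)).
  { apply (is_derive_on_scale phi _ _ _ xi); [| | exact Hcx | |].
    - apply Rdiv_lt_0_compat; lra.
    - rewrite Es; field; lra.
    - intros y Hy; rewrite u_def by assumption.
      f_equal; f_equal; fold c; field; lra.
    - replace (1 / c * (c * x)) with x by (field; lra).
      apply phi_C2; exact Hx. }
  split.
  - intros H'; exact (is_derive_on_unique _ _ _ _ _ _ Hs Hcx H' H).
  - intros ->; exact H.
Qed.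

Lemma is_derive_free_boundary (t : R) : 0 < t ->
  is_derive s t (xi * a / sqrt t).
Proof.
  intros Ht; apply (is_derive_ext_loc (fun tau => 2 * xi * a * sqrt tau)).
  - apply (locally_interval _ t 0 p_infty); [exact Ht | exact I |].
    intros y Hy _; symmetry; now apply s_def.
  - pose proof (sqrt_lt_R0 t Ht); auto_derive; [exact Ht | field; lra].
Qed.

End Similarity.

(** * Reduction to a boundary value problem for the profile *)

(** At each time every boundary condition is its profile version times a positive function of [t].
    Dividing at time 1 gives one direction, multiplying at arbitrary [t] the other. *)
Lemma robin_problem_similarity_iff (a k gamma h0 uinf beta delta xi : R)
    (phi f1 f2 : R -> R) (u : R -> R -> R) (s : R -> R) :
  0 < a -> 0 < xi ->
  (forall t, 0 < t -> s t = 2 * xi * a * sqrt t) ->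
  (forall x t, 0 < t -> 0 <= x <= s t ->
     u x t = Rpower t ((beta - delta) / 2) * phi (x / (2 * a * sqrt t))) ->
  (forall x, cc_interval 0 xi x ->
     is_derive_on phi (cc_interval 0 xi) x (f1 x) /\
     is_derive_on f1 (cc_interval 0 xi) x (f2 x) /\
     continue_in f2 (cc_interval 0 xi) x) ->
  robin_problem a k gamma h0 uinf beta delta u s <->
  (forall x, 0 < x < xi ->
     f2 x = 2 * (beta - delta) * phi x - 2 * x * f1 x) /\
  phi xi = 0 /\
  - k * f1 xi = gamma * (Rpower 2 (beta + 1) * Rpower a (beta + delta + 2)
    * Rpower xi (beta + delta + 1)) /\
  s 0 = 0 /\
  k * f1 0 = 2 * a * h0 * (phi 0 - uinf).
Proof.
  intros Ha Hxi Hs Hu HC.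
  set (alpha := beta - delta) in *.
  unfold robin_problem.
  rewrite (heat_equation_iff a alpha xi phi f1 f2 u s Ha Hxi Hs Hu HC).
  assert (Tpos : forall t, 0 < t ->
    0 < Rpower t (alpha / 2) * (1 / (2 * a * sqrt t))).
  { intros t Ht; apply Rmult_lt_0_compat; [apply exp_pos|].
    apply Rdiv_lt_0_compat; [lra | now apply scale_pos]. }
  assert (Dxi : forall t ux, 0 < t ->
    is_derive_on (fun y => u y t) (cc_interval 0 (s t)) (s t) ux <->
    ux = Rpower t (alpha / 2) * (1 / (2 * a * sqrt t)) * f1 xi).
  { intros t ux Ht.
    rewrite <- (similarity_boundary_derive a alpha xi phi f1 f2 u s
      Ha Hxi Hs Hu HC xi ux t Ht) by lra.
    replace (2 * a * sqrt t * xi) with (s t)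
      by (rewrite Hs by exact Ht; ring).
    reflexivity. }
  assert (D0 : forall t ux, 0 < t ->
    is_derive_on (fun y => u y t) (cc_interval 0 (s t)) 0 ux <->
    ux = Rpower t (alpha / 2) * (1 / (2 * a * sqrt t)) * f1 0).
  { intros t ux Ht.
    rewrite <- (similarity_boundary_derive a alpha xi phi f1 f2 u s
      Ha Hxi Hs Hu HC 0 ux t Ht) by lra.
    rewrite Rmult_0_r; reflexivity. }
  assert (U0 : forall t, 0 < t -> u 0 t = Rpower t (alpha / 2) * phi 0).
  { intros t Ht; rewrite Hu;
      [unfold Rdiv at 2; now rewrite Rmult_0_l | exact Ht |].
    pose proof (free_boundary_pos a xi s Ha Hxi Hs t Ht); lra. }
  assert (Stefan : forall t ux, 0 < t ->
    ux = Rpower t (alpha / 2) * (1 / (2 * a * sqrt t)) * f1 xi ->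
    (- k * ux =
       gamma * Rpower (s t) beta * Rpower (Derive s t) delta * Derive s t <->
     - k * f1 xi = gamma * (Rpower 2 (beta + 1) * Rpower a (beta + delta + 2)
       * Rpower xi (beta + delta + 1)))).
  { intros t ux Ht ->; specialize (Tpos t Ht).
    rewrite (is_derive_unique _ _ _ (is_derive_free_boundary a xi s Hs t Ht)).
    rewrite (Hs t Ht), (Rmult_assoc gamma), (Rmult_assoc gamma).
    rewrite stefan_power by assumption; fold alpha.
    set (T := Rpower t (alpha / 2) * (1 / (2 * a * sqrt t))) in *.
    split; intros H.
    - apply Rmult_eq_reg_l with T; lra.
    - apply (Rmult_eq_compat_l T) in H; lra. }
  assert (Robin : forall t ux, 0 < t ->
    ux = Rpower t (alpha / 2) * (1 / (2 * a * sqrt t)) * f1 0 ->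
    (k * ux = h0 / sqrt t * (u 0 t - uinf * Rpower t (alpha / 2)) <->
     k * f1 0 = 2 * a * h0 * (phi 0 - uinf))).
  { intros t ux Ht ->; specialize (Tpos t Ht); rewrite U0 by exact Ht.
    replace (h0 / sqrt t * (Rpower t (alpha / 2) * phi 0
        - uinf * Rpower t (alpha / 2)))
      with (Rpower t (alpha / 2) * (1 / (2 * a * sqrt t))
            * (2 * a * h0 * (phi 0 - uinf)))
      by (pose proof (sqrt_lt_R0 t Ht); field; lra).
    set (T := Rpower t (alpha / 2) * (1 / (2 * a * sqrt t))) in *.
    split; intros H.
    - apply Rmult_eq_reg_l with T; lra.
    - apply (Rmult_eq_compat_l T) in H; lra. }
  split.
  - intros (H1 & H2 & H3 & H4 & H5).
    split; [exact H1|]; split; [|split; [|split; [exact H4|]]].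
    + specialize (H2 1 Rlt_0_1).
      rewrite (similarity_boundary_value a alpha xi phi u s Ha Hxi Hs Hu)
        in H2 by lra.
      apply Rmult_integral in H2; destruct H2 as [H2|H2]; [|exact H2].
      unfold Rpower in H2; pose proof (exp_pos (alpha / 2 * ln 1)); lra.
    + destruct (H3 1 Rlt_0_1) as [_ [ux [Hux E]]].
      apply (Stefan 1 ux Rlt_0_1); [|exact E].
      apply Dxi; [lra | exact Hux].
    + destruct (H5 1 Rlt_0_1) as [ux [Hux E]].
      apply (Robin 1 ux Rlt_0_1); [|exact E].
      apply D0; [lra | exact Hux].
  - intros (H1 & H2 & H3 & H4 & H5).
    split; [exact H1|]; split; [|split; [|split; [exact H4|]]].
    + intros t Ht.
      rewrite (similarity_boundary_value a alpha xi phi u s Ha Hxi Hs Hu),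
        H2 by exact Ht; ring.
    + intros t Ht; split.
      { eexists; now apply (is_derive_free_boundary a xi s Hs). }
      eexists; split; [apply Dxi; [exact Ht | reflexivity]|].
      apply Stefan; [exact Ht | reflexivity | exact H3].
    + intros t Ht.
      eexists; split; [apply D0; [exact Ht | reflexivity]|].
      apply Robin; [exact Ht | reflexivity | exact H5].
Qed.

(** * Coefficients and boundary slope of the Robin profile *)

Definition f1_denominator (a k h0 alpha z : R) : R :=
  k / (2 * a * h0) * even_kummer 1 (alpha / 2 + 1 / 2) z
  + odd_kummer 1 (alpha / 2 + 1) z.

Lemma f1_eq (a k h0 alpha z : R) :
  f1 a k h0 alpha z = 1 / f1_denominator a k h0 alpha z.
Proof.
  unfold f1, f1_denominator, even_kummer, odd_kummer; now rewrite Rmult_1_l.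
Qed.

Lemma phi1_eq (alpha z : R) :
  kummerM (- alpha / 2) (1 / 2) (- z ^ 2) = phi1 alpha z.
Proof. unfold phi1, even_kummer; f_equal; ring. Qed.

Lemma phi2_eq (alpha z : R) :
  z * kummerM (- alpha / 2 + 1 / 2) (3 / 2) (- z ^ 2) = phi2 alpha z.
Proof. unfold phi2, odd_kummer; do 2 f_equal; ring. Qed.

(** Kummer's transformation applies to both terms, so the denominators of the coefficients and of
    [f1] differ by a Gaussian; positivity passes from the latter to the former. *)
Lemma robin_denominator_eq (a k h0 alpha z : R) : 0 <= z ->
  robin_denominator a k h0 alpha z
  = exp (- z ^ 2) * f1_denominator a k h0 alpha z.
Proof.
  intros Hz; unfold robin_denominator, f1_denominator.
  rewrite phi1_eq, phi2_eq, kummer_transform_even, kummer_transform_odd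
    by exact Hz; ring.
Qed.

Lemma f1_denominator_0 (a k h0 alpha : R) :
  f1_denominator a k h0 alpha 0 = k / (2 * a * h0).
Proof.
  unfold f1_denominator; rewrite even_kummer_0, odd_kummer_0; ring.
Qed.

Section Robin.

Variables a k h0 uinf alpha : R.
Hypothesis a_pos : 0 < a.
Hypothesis k_pos : 0 < k.
Hypothesis h0_pos : 0 < h0.
Hypothesis alpha_nonneg : 0 <= alpha.

Lemma robin_ratio_pos : 0 < k / (2 * a * h0).
Proof.
  apply Rdiv_lt_0_compat; [exact k_pos|].
  repeat apply Rmult_lt_0_compat; lra.
Qed.

Lemma f1_denominator_le (x y : R) : 0 <= x <= y ->
  f1_denominator a k h0 alpha x <= f1_denominator a k h0 alpha y.
Proof.
  intros Hxy; pose proof robin_ratio_pos.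
  apply Rplus_le_compat; [apply Rmult_le_compat_l; [lra|]|].
  - apply even_kummer_le; lra.
  - apply odd_kummer_le; lra.
Qed.

Lemma f1_denominator_pos (z : R) : 0 <= z ->
  0 < f1_denominator a k h0 alpha z.
Proof.
  intros Hz; apply Rlt_le_trans with (f1_denominator a k h0 alpha 0).
  - rewrite f1_denominator_0; exact robin_ratio_pos.
  - apply f1_denominator_le; lra.
Qed.

Lemma continuity_pt_f1_denominator (z : R) :
  continuity_pt (f1_denominator a k h0 alpha) z.
Proof.
  apply continuity_pt_plus; [apply continuity_pt_mult|].
  - apply continuity_pt_const; intros ? ?; reflexivity.
  - eapply is_derive_continuity_pt, is_derive_even_kummer.
  - eapply is_derive_continuity_pt, is_derive_odd_kummer.
Qed.

(** Here [c1] and [c2] stand for the value and slope of the profile at 0. Eliminating [c1] by the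
    Robin condition leaves a linear equation for [c2] whose coefficient is the positive
    [robin_denominator]. *)
Lemma robin_coefficients_iff (xi c1 c2 : R) : 0 < xi ->
  (c1 * phi1 alpha xi + c2 * phi2 alpha xi = 0 /\
   k * c2 = 2 * a * h0 * (c1 - uinf)) <->
  (c1 = C1R a k h0 uinf alpha xi /\ c2 = C2R a k h0 uinf alpha xi).
Proof.
  intros Hxi.
  assert (Hd : 0 < robin_denominator a k h0 alpha xi).
  { rewrite robin_denominator_eq by lra.
    apply Rmult_lt_0_compat; [apply exp_pos | apply f1_denominator_pos; lra]. }
  unfold C1R, C2R; rewrite (Rmult_assoc uinf xi).
  unfold robin_denominator in *; rewrite phi1_eq, phi2_eq in *.
  set (A := phi1 alpha xi) in *; set (B := phi2 alpha xi) in *.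
  pose proof robin_ratio_pos as HK.
  assert (Eq : k * c2 = 2 * a * h0 * (c1 - uinf) <->
    c1 = uinf + k / (2 * a * h0) * c2).
  { assert (0 < 2 * a * h0) by (repeat apply Rmult_lt_0_compat; lra).
    split; intros H1.
    - apply Rmult_eq_reg_l with (2 * a * h0); [|lra].
      transitivity (2 * a * h0 * uinf + k * c2); [lra | field; lra].
    - rewrite H1; field; lra. }
  rewrite Eq; set (K := k / (2 * a * h0)) in *.
  split; intros [E1 E2].
  - assert (E3 : c2 * (K * A + B) = - uinf * A) by (rewrite E2 in E1; lra).
    assert (E4 : c2 = - uinf * A / (K * A + B)) by (rewrite <- E3; field; lra).
    split; [rewrite E2, E4; field; lra | exact E4].
  - rewrite E1, E2; split; field; lra.
Qed.

(** Over the common denominator the numerator is [- uinf] times the Wronskian of [phi1] and [phi2];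
    its value [exp (- xi ^ 2)] cancels the Gaussian of [robin_denominator]. *)
Lemma robin_boundary_slope (xi : R) : 0 < xi ->
  C1R a k h0 uinf alpha xi * dphi1 alpha xi
  + C2R a k h0 uinf alpha xi * dphi2 alpha xi = - uinf * f1 a k h0 alpha xi.
Proof.
  intros Hxi.
  pose proof (f1_denominator_pos xi (Rlt_le _ _ Hxi)) as HD.
  pose proof (exp_pos (- xi ^ 2)) as HE.
  unfold C1R, C2R; rewrite (Rmult_assoc uinf xi), phi1_eq, phi2_eq.
  rewrite robin_denominator_eq, f1_eq by lra.
  transitivity (- uinf * (phi1 alpha xi * dphi2 alpha xi
      - dphi1 alpha xi * phi2 alpha xi)
    / (exp (- xi ^ 2) * f1_denominator a k h0 alpha xi)).
  - field; lra.
  - rewrite phi_wronskian by lra; field; lra.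
Qed.

End Robin.

Lemma stefan_condition_iff (a k gamma uinf beta delta xi F : R) :
  0 < gamma ->
  (- k * (- uinf * F) = gamma * (Rpower 2 (beta + 1)
     * Rpower a (beta + delta + 2) * Rpower xi (beta + delta + 1))) <->
  k * uinf / (gamma * Rpower 2 (beta + 1) * Rpower a (beta + delta + 2)) * F
    = Rpower xi (beta + delta + 1).
Proof.
  intros Hg.
  assert (H2 : 0 < Rpower 2 (beta + 1)) by apply exp_pos.
  assert (Ha : 0 < Rpower a (beta + delta + 2)) by apply exp_pos.
  split; intros H.
  - transitivity (- k * (- uinf * F)
      / (gamma * Rpower 2 (beta + 1) * Rpower a (beta + delta + 2)));
      [field; lra | rewrite H; field; lra].
  - rewrite <- H; field; lra.
Qed.

(** One-sided differentiability gives continuity of the clamped functions at the endpoints; inside,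
    clamping is locally the identity. *)
Lemma similarity_ode_of_C2 (alpha xi : R) (phi f1 f2 : R -> R) :
  (forall x, cc_interval 0 xi x ->
     is_derive_on phi (cc_interval 0 xi) x (f1 x) /\
     is_derive_on f1 (cc_interval 0 xi) x (f2 x) /\
     continue_in f2 (cc_interval 0 xi) x) ->
  (forall x, 0 < x < xi -> f2 x = 2 * alpha * phi x - 2 * x * f1 x) ->
  similarity_ode alpha xi
    (fun x => phi (clamp xi x)) (fun x => f1 (clamp xi x)).
Proof.
  intros HC Hode; split; intros x Hx.
  - destruct (HC x Hx) as (D & D1 & _).
    split; apply continuity_pt_clamp; try exact Hx; eapply cont_deriv;
      [exact D | exact D1].
  - destruct (HC x ltac:(unfold cc_interval; lra)) as (D & D1 & _).
    apply (is_derive_of_is_derive_on _ 0 xi) in D; [|exact Hx].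
    apply (is_derive_of_is_derive_on _ 0 xi) in D1; [|exact Hx].
    rewrite clamp_id by lra; rewrite Hode in D1 by exact Hx.
    split; now apply is_derive_clamp.
Qed.

(** * Existence and uniqueness of the similarity solution *)

Theorem corollary2p2 (a k gamma h0 uinf beta delta : R)
  (ha : 0 < a) (hk : 0 < k) (hgamma : 0 < gamma) (hh0 : 0 < h0)
  (huinf : 0 < uinf) (hbd : beta >= delta) (hbd1 : beta + delta + 1 > 0) :
  let alpha := beta - delta in
  exists xiR : R,
    unique (fun z => 0 < z /\
      k * uinf / (gamma * Rpower 2 (beta + 1) * Rpower a (beta + delta + 2))
        * f1 a k h0 alpha z = Rpower z (beta + delta + 1)) xiR /\
    similarity_type a alpha (uR a k h0 uinf alpha xiR) (sR a xiR) /\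
    robin_problem a k gamma h0 uinf beta delta
      (uR a k h0 uinf alpha xiR) (sR a xiR) /\
    (forall (u : R -> R -> R) (s : R -> R),
      similarity_type a alpha u s ->
      robin_problem a k gamma h0 uinf beta delta u s ->
      (forall t, 0 <= t -> s t = sR a xiR t) /\
      (forall x t, 0 < t -> 0 <= x <= sR a xiR t ->
        u x t = uR a k h0 uinf alpha xiR x t)).
Proof.
  intros alpha.
  assert (Halpha : 0 <= alpha) by (unfold alpha; lra).
  destruct (exists_unique_power_balance
    (k * uinf / (gamma * Rpower 2 (beta + 1) * Rpower a (beta + delta + 2)))
    (beta + delta + 1) (f1_denominator a k h0 alpha)) as [xi [[Hxi Exi] Huniq]].
  { apply Rdiv_lt_0_compat; repeat apply Rmult_lt_0_compat; try assumption;
      apply exp_pos. }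
  { exact hbd1. }
  { apply continuity_pt_f1_denominator. }
  { apply f1_denominator_pos; lra. }
  { intros x y; now apply f1_denominator_le. }
  rewrite <- f1_eq in Exi.
  exists xi.
  assert (UR : forall x t, uR a k h0 uinf alpha xi x t =
    Rpower t (alpha / 2) *
      (C1R a k h0 uinf alpha xi * phi1 alpha (x / (2 * a * sqrt t))
       + C2R a k h0 uinf alpha xi * phi2 alpha (x / (2 * a * sqrt t)))).
  { intros x t; unfold uR; cbv zeta.
    now rewrite (Rmult_assoc (C2R _ _ _ _ _ _)), phi2_eq, phi1_eq. }
  set (c1 := C1R a k h0 uinf alpha xi) in *.
  set (c2 := C2R a k h0 uinf alpha xi) in *.
  set (phi := fun x => c1 * phi1 alpha x + c2 * phi2 alpha x).
  set (dphi := fun x => c1 * dphi1 alpha x + c2 * dphi2 alpha x).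
  (* The second derivative is defined by the similarity equation, which therefore holds by
     reflexivity. *)
  set (ddphi := fun x => 2 * alpha * phi x - 2 * x * dphi x).
  assert (Dphi : forall x : R, is_derive phi x (dphi x)).
  { intros x; unfold phi, dphi.
    apply (is_derive_plus (fun y => c1 * phi1 alpha y)).
    - apply is_derive_scal, is_derive_phi1.
    - apply is_derive_scal, is_derive_phi2. }
  assert (Ddphi : forall x : R, is_derive dphi x (ddphi x)).
  { intros x; unfold dphi.
    replace (ddphi x) with
      (c1 * (2 * alpha * phi1 alpha x - 2 * x * dphi1 alpha x)
       + c2 * (2 * alpha * phi2 alpha x - 2 * x * dphi2 alpha x))
      by (unfold ddphi, phi, dphi; ring).
    apply (is_derive_plus (fun y => c1 * dphi1 alpha y)).
    - apply is_derive_scal, is_derive_dphi1.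
    - apply is_derive_scal, is_derive_dphi2. }
  assert (HC2 : forall x, cc_interval 0 xi x ->
     is_derive_on phi (cc_interval 0 xi) x (dphi x) /\
     is_derive_on dphi (cc_interval 0 xi) x (ddphi x) /\
     continue_in ddphi (cc_interval 0 xi) x).
  { intros x _; repeat split; try (apply is_derive_on_of_is_derive; auto).
    eapply cont_deriv, is_derive_on_of_is_derive.
    unfold ddphi; auto_derive; [|reflexivity].
    repeat split; eexists; eauto. }
  destruct (robin_coefficients_iff a k h0 uinf alpha ha hk hh0 Halpha
    xi c1 c2 Hxi) as [_ Hc].
  destruct (Hc (conj eq_refl eq_refl)) as [Hc1 Hc2]; clear Hc.
  assert (Phi0 : forall d1 d2, d1 * phi1 alpha 0 + d2 * phi2 alpha 0 = d1).
  { intros; unfold phi1, phi2; rewrite even_kummer_0, odd_kummer_0; ring. }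
  assert (dPhi0 : forall d1 d2, d1 * dphi1 alpha 0 + d2 * dphi2 alpha 0 = d2).
  { intros; unfold dphi1, dphi2; rewrite even_kummer1_0, odd_kummer1_0; ring. }
  split; [|split; [|split]].
  - split; [now split|]; intros z Hz; apply Huniq; now rewrite f1_eq in Hz.
  - exists phi, xi; split; [exact Hxi|]; split; [now exists dphi, ddphi|].
    split; [reflexivity|]; intros x t _ _; apply UR.
  - apply (robin_problem_similarity_iff a k gamma h0 uinf beta delta xi
      phi dphi ddphi); try assumption.
    + reflexivity.
    + intros x t _ _; apply UR.
    + split; [reflexivity|]; split; [exact Hc1|]; split; [|split].
      * unfold dphi, c1, c2; rewrite robin_boundary_slope by assumption.
        now apply stefan_condition_iff.
      * unfold sR; rewrite sqrt_0; ring.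
      * unfold dphi, phi; rewrite Phi0, dPhi0; exact Hc2.
  (* Uniqueness: the profile of any other solution is fixed by its Cauchy data at 0, which the Robin
     condition and the zero at [xi'] determine. *)
  - intros u s (psi & xi' & Hxi' & (g1 & g2 & HC) & Hs & Hu) Hprob.
    apply (robin_problem_similarity_iff a k gamma h0 uinf beta delta xi'
      psi g1 g2 u s ha Hxi' Hs Hu HC) in Hprob.
    destruct Hprob as (Hode & Hend & Hstefan & Hs0 & Hrobin).
    pose proof (similarity_ode_solution _ _ _ _
      (similarity_ode_of_C2 alpha xi' psi g1 g2 HC Hode)) as Hsol.
    cbv beta in Hsol; rewrite (clamp_id xi' 0) in Hsol by lra.
    assert (Hsol' : forall x, 0 <= x <= xi' ->
      psi x = psi 0 * phi1 alpha x + g1 0 * phi2 alpha x /\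
      g1 x = psi 0 * dphi1 alpha x + g1 0 * dphi2 alpha x).
    { intros x Hx; rewrite <- (clamp_id xi' x) at 1 4 by exact Hx.
      now apply Hsol. }
    destruct (Hsol' xi') as [E1 E2]; [lra|].
    rewrite Hend in E1.
    destruct (robin_coefficients_iff a k h0 uinf alpha ha hk hh0 Halpha
      xi' (psi 0) (g1 0) Hxi') as [Hc _].
    destruct (Hc (conj (eq_sym E1) Hrobin)) as [P0 G0]; clear Hc.
    rewrite E2, P0, G0, robin_boundary_slope in Hstefan by assumption.
    apply stefan_condition_iff in Hstefan; [|exact hgamma].
    rewrite f1_eq in Hstefan.
    (* The Stefan condition makes [xi'] a second positive root of the scalar equation. *)
    assert (Exi' : xi = xi') by (apply Huniq; now split).
    subst xi'; fold c1 in P0; fold c2 in G0; split.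
    (* The similarity form describes [s] for positive times only; at 0 the initial condition is
       used. *)
    + intros t [Ht|<-]; [now apply Hs|].
      rewrite Hs0; unfold sR; rewrite sqrt_0; ring.
    + intros x t Ht Hx.
      rewrite UR, (Hu x t Ht) by (rewrite Hs by exact Ht; exact Hx).
      f_equal; rewrite <- P0, <- G0; apply Hsol'.
      pose proof (scale_pos a ha t Ht).
      unfold sR in Hx; split; [apply Rdiv_le_0_compat; lra|].
      apply Rle_div_l; lra.
Qed.
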